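(* Let $G$ be a connected graph with $n\geq 3$ vertices. For every two integers $s$ and $r$ with $s\geq 0$ and $r\in\{0,1,2,3\}$, if $\lambda(G)=4s+r$, then $$\lambda_3(G)\geq 3s+\left\lceil\frac{r}{2}\right\rceil.$$ In particular, $\lambda_3(G)\geq \frac{3\lambda(G)-2}{4}$. Moreover, the lower bound is tight: for all integers $s\geq 0$ and $r\in\{0,1,2,3\}$ with $4s+r\geq 1$ there is a connected graph $G$ with $\lambda(G)=4s+r$ and $\lambda_3(G)=3s+\lceil\frac{r}{2}\rceil$.
   Context: All graphs are undirected, finite and simple. $\lambda(G)$ is the edge-connectivity of $G$. For a graph $G$ and a set $S\subseteq V(G)$ of at least two vertices, a tree connecting $S$ is a subgraph $T$ of $G$ that is a tree with $S\subseteq V(T)$. Let $\lambda(S)$ be the maximum number of pairwise edge-disjoint trees connecting $S$ in $G$. The generalized $3$-edge-connectivity of $G$ is $\lambda_3(G)=\min\{\lambda(S) : S\subseteq V(G),\ |S|=3\}$. *)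

(* Defs.v *)
From HB Require Import structures.
From mathcomp Require Import all_boot all_order all_algebra.

Set Implicit Arguments.
Unset Strict Implicit.
Unset Printing Implicit Defensive.

Record sgraph := SGraph {
  vertex :> finType;
  adj : rel vertex;
  adj_sym : symmetric adj;
  adj_irr : irreflexive adj
}.

(* An edge is the two-element set of its ends. *)
Definition edges (G : sgraph) : {set {set G}} :=
  [set [set p.1; p.2] | p : G * G & adj p.1 p.2].

Section Subgraphs.
Variable V : finType.
Implicit Types (A : {set V}) (F : {set {set V}}).

Definition edge_rel F : rel V := fun x y => [set x; y] \in F.

(* In the next three definitions (A, F) is the graph with vertex set A and edge
   set F; they are used only when every member of F is a pair of distinct
   vertices of A, so walks starting in A never leave A. *)
Definition connected_graph A F : bool :=
  (A != set0) && [forall x in A, forall y in A, connect (edge_rel F) x y].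

(* ucycle accepts [:: x; y] for an edge xy, hence the bound 3 on the length of
   a genuine cycle; its vertices are distinct, so its length is at most #|V|. *)
Definition acyclic_graph F : bool :=
  [forall k : 'I_#|V|.+1, forall c : k.-tuple V,
    ucycleb (edge_rel F) c ==> (k < 3)].

Definition tree_graph A F : bool := connected_graph A F && acyclic_graph F.

End Subgraphs.

Definition connected_sgraph (G : sgraph) : bool :=
  connected_graph [set: G] (edges G).

(* Deleting all edges disconnects a graph with at least two vertices, so the
   default value #|edges G| of the minimum matters only for #|G| <= 1, where it
   is 0. *)
Definition edge_connectivity (G : sgraph) : nat :=
  \big[minn/#|edges G|]_(F : {set {set G}} |
      (F \subset edges G) && ~~ connected_graph [set: G] (edges G :\: F)) #|F|.

(* The pair H = (H.1, H.2) consists of a vertex set and an edge set. *)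
Definition is_subgraph (G : sgraph) (H : {set G} * {set {set G}}) : bool :=
  (H.2 \subset edges G) && [forall f in H.2, f \subset H.1].

Definition connecting_tree (G : sgraph) (S : {set G})
    (H : {set G} * {set {set G}}) : bool :=
  [&& is_subgraph H, tree_graph H.1 H.2 & S \subset H.1].

(* A tree connecting at least two vertices has an edge, so edge-disjoint such
   trees are distinct and a family of them may be taken to be a set. *)
Definition edge_disjoint_trees (G : sgraph) (S : {set G})
    (P : {set {set G} * {set {set G}}}) : bool :=
  [forall H in P, connecting_tree S H] &&
  [forall H in P, forall K in P, (H != K) ==> [disjoint H.2 & K.2]].

(* Meaningful for 2 <= #|S|. *)
Definition local_lambda (G : sgraph) (S : {set G}) : nat :=
  \max_(P : {set {set G} * {set {set G}}} | edge_disjoint_trees S P) #|P|.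

(* Meaningful for 3 <= #|G|; then local_lambda S <= #|edges G| for every S
   with three elements, so the default value does not affect the minimum. *)
Definition lambda3 (G : sgraph) : nat :=
  \big[minn/#|edges G|]_(S : {set G} | #|S| == 3) local_lambda S.

(* Main.v *)
Require Import Defs.
From HB Require Import structures.
From mathcomp Require Import all_boot all_order all_algebra zify.
Import Order.TTheory GRing.Theory Num.Theory.

Set Implicit Arguments.
Unset Strict Implicit.
Unset Printing Implicit Defensive.

(* Lower bound.  In a multigraph where every edge cut separating the terminals
   a, b, c has at least k edges, floor (ceil (3k / 2) / 2) edge-disjoint trees
   connect them.  This goes by induction on the number of edges.  A cut of size
   k with an edge inside the side X that contains a single terminal a is
   treated by contracting X to a, and completing the trees inside X by k
   edge-disjoint paths (Menger).  If there is no such cut, and no edge can be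
   deleted, every edge has an end at a terminal of degree k.  A non-terminal v
   of positive degree then has multiplicities to a, b, c that satisfy the
   strict triangle inequalities.  Either they are all 1, and the three edges at
   v form a tree whose removal costs one in k, or a pair of edges at v can be
   split off.  When all edges join terminals, the trees are paths of two edges
   of a triangle with multiple edges.

   Tightness.  Join three cliques of L + 1 vertices by matchings of sizes
   floor (L / 2), ceil (L / 2) and ceil (L / 2).  The edge-connectivity is L,
   and a tree that meets the three cliques uses two of the ceil (3L / 2)
   matching edges. *)

(** * Multigraphs: cuts, packings, contraction and splitting off *)

Section Multigraph.

Variables V E : finType.
Implicit Types (g : E -> V * V) (T X Z : {set V}) (D : {set E}) (k t : nat).

(** A multigraph is a map [g] from edges to pairs of ends. The order of the two ends is immaterial,
    and parallel edges and loops are allowed because contraction and splitting off create them. *)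
Definition cut g Z : {set E} :=
  [set e | ((g e).1 \in Z) != ((g e).2 \in Z)].

(** Its cardinality is the induction measure of the packing theorems, since [E] itself never
    shrinks. *)
Definition nonloops g : {set E} := [set e | (g e).1 != (g e).2].

Definition separates T Z : bool := ~~ [disjoint T & Z] && ~~ (T \subset Z).

Definition edge_connected g T k : bool :=
  [forall Z : {set V}, separates T Z ==> (k <= #|cut g Z|)].

(* A packing of t edge-disjoint connected subgraphs containing T is a colouring
   of the edges in which each colour i < t meets all cuts that separate T. *)
Definition packs g T t : bool :=
  [exists phi : {ffun E -> 'I_t.+1}, forall i : 'I_t, forall Z : {set V},
     separates T Z ==> [exists e in cut g Z, phi e == i :> nat]].

(* A loop lies in no cut, so that deleting an edge amounts to turning it into a
   loop; V and E remain the same in all the operations below. *)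
Definition delete D g : E -> V * V :=
  fun e => if e \in D then ((g e).1, (g e).1) else g e.

Definition contract X (x : V) g : E -> V * V :=
  let h y := if y \in X then x else y in fun e => (h (g e).1, h (g e).2).

(** Meant for edges [e = vx] and [f = vy] at a common vertex [v]: [e] becomes the new edge [xy] and
    [f] is discarded as a loop. *)
Definition split_off (e f : E) (x y : V) g : E -> V * V :=
  fun e0 => if e0 == e then (x, y) else if e0 == f then (x, x) else g e0.

Lemma separatesP T Z :
  reflect (exists x y, [/\ x \in T, y \in T, x \in Z & y \notin Z])
          (separates T Z).
Proof.
apply: (iffP andP) => [[/pred0Pn[x /andP[/= xT xZ]] /subsetPn[y yT yZ]]|].
  by exists x, y.
case=> x [y [xT yT xZ yZ]]; split; last by apply/subsetPn; exists y.
by apply/pred0Pn; exists x; rewrite /= xT.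
Qed.

Lemma separatesC T Z : separates T (~: Z) = separates T Z.
Proof.
by apply/separatesP/separatesP=> -[x [y [xT yT xZ yZ]]]; exists y, x;
   split; rewrite // ?inE ?negbK // in xZ yZ *.
Qed.

Lemma cutC g Z : cut g (~: Z) = cut g Z.
Proof. by apply/setP=> e; rewrite !inE; do 2!case: (_ \in _). Qed.

Lemma cut_contract X x g Z :
  cut (contract X x g) Z =
  cut g [set y | (if y \in X then x else y) \in Z].
Proof. by apply/setP=> e; rewrite !inE. Qed.

Lemma cut_delete D g Z : cut (delete D g) Z = cut g Z :\: D.
Proof.
by apply/setP=> e; rewrite !inE /delete; case: (e \in D); rewrite //= eqxx.
Qed.

Lemma nonloops_delete D g : nonloops (delete D g) = nonloops g :\: D.
Proof.
by apply/setP=> e; rewrite !inE /delete; case: (e \in D); rewrite //= eqxx.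
Qed.

Lemma cut_nonloops g Z : cut g Z \subset nonloops g.
Proof. by apply/subsetP=> e; rewrite !inE; apply: contraNneq => ->. Qed.

Lemma edge_connectedP g T k :
  reflect (forall Z, separates T Z -> k <= #|cut g Z|) (edge_connected g T k).
Proof. exact: 'forall_implyP. Qed.

Lemma packsP g T t :
  reflect (exists phi : E -> nat, forall i Z, i < t -> separates T Z ->
             exists2 e, e \in cut g Z & phi e = i)
          (packs g T t).
Proof.
apply: (iffP existsP) => [[phi /forallP phiP]|[phi phiP]].
  exists (fun e => nat_of_ord (phi e)) => i Z lt_it sepZ.
  have /forallP/(_ Z)/implyP/(_ sepZ)/existsP[e /andP[eZ /eqP phie]] :=
    phiP (Ordinal lt_it).
  by exists e.
(* Colours above [t] become 0 under [inord], which only enlarges a class. *)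
exists [ffun e => inord (phi e)]; apply/forallP=> i; apply/forallP=> Z.
apply/implyP=> sepZ; have [e eZ phie] := phiP i Z (ltn_ord i) sepZ.
by apply/existsP; exists e; rewrite eZ ffunE phie inordK ?eqxx // leqW.
Qed.

Lemma packs_leq g T t t' : t <= t' -> packs g T t' -> packs g T t.
Proof.
move=> le_tt' /packsP[phi phiP]; apply/packsP; exists phi => i Z lt_it.
exact/phiP/(leq_trans lt_it).
Qed.

Lemma packs_delete D g T t : packs (delete D g) T t -> packs g T t.
Proof.
case/packsP=> phi phiP; apply/packsP; exists phi => i Z lt_it sepZ.
have [e] := phiP i Z lt_it sepZ; rewrite cut_delete => /setDP[eZ _] <-.
by exists e.
Qed.

(** The edges of [D] take the new colour [t]; the other classes are found outside [D]. *)
Lemma packs_add_tree D g T t :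
    (forall Z, separates T Z -> exists2 e, e \in D & e \in cut g Z) ->
  packs (delete D g) T t -> packs g T t.+1.
Proof.
move=> spanD /packsP[phi phiP]; apply/packsP.
exists (fun e => if e \in D then t else phi e) => i Z.
rewrite ltnS leq_eqVlt => /predU1P[->|lt_it] sepZ.
  by have [e eD eZ] := spanD Z sepZ; exists e; rewrite ?eD.
have [e] := phiP i Z lt_it sepZ; rewrite cut_delete => /setDP[eZ eD] <-.
by exists e; rewrite // (negPf eD).
Qed.

(** For distinct [v] and [x], an edge in the cuts of both vertices has exactly these two ends, in
    one order or the other. *)
Lemma cut_between g v x Z e :
    v != x -> e \in cut g [set v] :&: cut g [set x] ->
  (e \in cut g Z) = ((v \in Z) != (x \in Z)).
Proof.
move=> vx; rewrite !inE; case: (g e) => y z /=.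
have [->|yv] := eqVneq y v.
  by rewrite (negPf vx); case: (z == v) => //=; case: (eqVneq z x) => // ->.
case: (eqVneq z v) => //= ->; rewrite (negPf vx).
by case: (eqVneq y x) => //= ->; rewrite eq_sym.
Qed.

(** The new edge [xy] of a tree is replaced by the path [x v y]: [f] takes the colour of [e], and a
    set separating [x] from [y] separates [v] from one of them. *)
Lemma packs_split_off e f x y v g T t :
    e \in cut g [set v] :&: cut g [set x] ->
    f \in cut g [set v] :&: cut g [set y] -> v != x -> v != y ->
  packs (split_off e f x y g) T t -> packs g T t.
Proof.
move=> ge gf vx vy /packsP[phi phiP]; apply/packsP.
exists (fun e0 => phi (if e0 == f then e else e0)) => i Z lt_it sepZ.
have [e0] := phiP i Z lt_it sepZ.
rewrite inE /split_off; have [->|ne_e] := eqVneq e0 e; last first.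
  have [->|ne_f] := eqVneq e0 f; first by rewrite eqxx.
  by move=> e0Z phie0; exists e0; rewrite ?inE ?(negPf ne_f).
move=> /= xyZ phie; have eZ := cut_between Z vx ge.
have fZ := cut_between Z vy gf; case: (boolP (f \in cut g Z)) => [fZ'|].
  by exists f; rewrite ?eqxx.
rewrite fZ negbK => /eqP vyZ; exists e; last by case: eqP.
by rewrite eZ vyZ eq_sym.
Qed.

(** If [x] and [y] are on different sides, exactly one of [e] and [f] crosses, and the new edge
    makes up for it. Otherwise both cross or neither does, and the new edge does not. *)
Lemma card_cut_split_off e f x y v g Z :
    e \in cut g [set v] :&: cut g [set x] ->
    f \in cut g [set v] :&: cut g [set y] -> e != f -> v != x -> v != y ->
  #|cut g Z| = #|cut (split_off e f x y g) Z| +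
    (((x \in Z) == (y \in Z)) && ((v \in Z) != (x \in Z))).*2.
Proof.
move=> ge gf ef vx vy; have eZ := cut_between Z vx ge.
have fZ := cut_between Z vy gf.
rewrite (cardsD1 e (cut g Z)) (cardsD1 f (_ :\ e)).
rewrite (cardsD1 e (cut (split_off _ _ _ _ _) Z)) (cardsD1 f (_ :\ e)).
have -> : cut (split_off e f x y g) Z :\ e :\ f = cut g Z :\ e :\ f.
  apply/setP=> e0; rewrite !inE /split_off.
  by case: (e0 == f); case: (e0 == e).
rewrite !in_setD1 eZ fZ (eq_sym f) ef !inE /split_off eqxx (eq_sym f)
  (negPf ef).
rewrite eqxx /=; by do 3!case: (_ \in Z); rewrite ?add1n ?add0n ?addn0 ?addn2.
Qed.

Lemma card_nonloops_split_off e f x y v g :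
    e \in cut g [set v] :&: cut g [set x] ->
    f \in cut g [set v] :&: cut g [set y] -> e != f ->
  #|nonloops (split_off e f x y g)| < #|nonloops g|.
Proof.
move=> /setIP[ge _] /setIP[gf _] ef.
have fL := subsetP (cut_nonloops g _) f gf.
have eL := subsetP (cut_nonloops g _) e ge.
apply: proper_card; apply/properP; split; last first.
  by exists f; rewrite // inE /split_off eqxx (eq_sym f) (negPf ef) eqxx.
apply/subsetP=> e0; rewrite !inE /split_off; have [->|_] := eqVneq e0 e.
  by rewrite inE in eL.
by have [->|] := eqVneq e0 f; rewrite ?eqxx.
Qed.

Lemma card_nonloops_delete D g e :
  e \in nonloops g -> e \in D -> #|nonloops (delete D g)| < #|nonloops g|.
Proof.
move=> eL eD; rewrite nonloops_delete; apply/proper_card/properP.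
by split; [exact: subsetDl | exists e; rewrite // inE eD].
Qed.

Lemma card_nonloops_contract X x g e :
    e \in nonloops g -> (g e).1 \in X -> (g e).2 \in X ->
  #|nonloops (contract X x g)| < #|nonloops g|.
Proof.
move=> eL e1 e2; apply/proper_card/properP; split.
  by apply/subsetP=> e0; rewrite !inE; apply: contraNneq => /= ->.
by exists e; rewrite // inE /= e1 e2 eqxx.
Qed.

(** A cut of the contraction is the cut of a preimage, which separates the same terminals because
    [X] has none besides possibly [x]. *)
Lemma edge_connected_contract X x g T k :
    (forall z, z \in T -> z \in X -> z = x) -> x \in X ->
  edge_connected g T k -> edge_connected (contract X x g) T k.
Proof.
move=> TX xX /edge_connectedP gk; apply/edge_connectedP => Z /separatesP.
case=> y [z [yT zT yZ zZ]]; rewrite cut_contract; apply/gk/separatesP.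
exists y, z; split; rewrite // inE; case: ifP => // zX.
  by rewrite -(TX y).
by rewrite -(TX z).
Qed.

(** Without an edge inside [X], every edge at [x] leaves [X]; the inclusion of cuts is an equality
    by cardinality. *)
Lemma cut_free X x g :
    x \in X -> ~~ [exists e
      in nonloops g, ((g e).1 \in X) && ((g e).2 \in X)] ->
  #|cut g X| <= #|cut g [set x]| -> cut g X = cut g [set x].
Proof.
move=> xX; rewrite negb_exists_in => /forall_inP freeX leXx.
apply/esym/eqP; rewrite eqEcard leXx andbT; apply/subsetP=> e ex.
have := freeX e (subsetP (cut_nonloops _ _) e ex).
move: ex; rewrite !inE; case: (eqVneq (g e).1 x) => [->|_].
  by rewrite xX /=; case: (_ \in X); case: (_ == x).
by case: (eqVneq (g e).2 x) => [->|_] //=; rewrite xX andbT => _ /negPf->.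
Qed.

(* A k-edge cut X is replaced by a terminal on either side.  In the contraction
   of the complement, each of the k trees contains exactly one edge of the cut,
   hence is a path that continues this edge up to x; a tree of the contraction
   of X is completed by these paths. *)
Lemma packs_glue X x y g T t :
    x \in T -> x \in X -> y \notin X ->
    (forall z, z \in T -> z \in X -> z = x) ->
    packs (contract X x g) T t ->
    packs (contract (~: X) y g) [set x; y] #|cut g X| ->
  packs g T t.
Proof.
move=> xT xX yX TX /packsP[phi phiP] /packsP[psi psiP].
have cut2 Z : Z \subset X -> cut (contract (~: X) y g) Z = cut g Z.
  move=> ZX; rewrite cut_contract; congr (cut g _); apply/setP=> z;
    rewrite !inE.
  case: (boolP (z \in X)) => //= zX.
  by rewrite (contraNF (subsetP ZX y)) // (contraNF (subsetP ZX z)).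
have sep2 Z : Z \subset X -> x \in Z -> separates [set x; y] Z.
  move=> ZX xZ; apply/separatesP; exists x, y; rewrite !inE !eqxx orbT.
  by split; rewrite // (contra (subsetP ZX y)).
(* Each of the [#|cut g X|] colours occurs on the cut, so [psi] is a bijection from the cut to the
   colours. *)
have psi_onto i : i < #|cut g X| -> exists2 e, e \in cut g X & psi e = i.
  by move=> lt_i; have [e] := psiP i X lt_i (sep2 X (subxx _) xX);
     rewrite cut2 //; exists e.
have sub_psi : {subset iota 0 #|cut g X| <= [seq psi e | e in cut g X]}.
  move=> i; rewrite mem_iota add0n => /psi_onto[e eX <-].
  by apply/imageP; exists e.
have le_psi : size [seq psi e | e in cut g X] <= size (iota 0 #|cut g X|).
  by rewrite size_image size_iota.
have psi_inj : {in cut g X &, injective psi}.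
  by apply/dinjectiveP; apply: leq_size_uniq sub_psi le_psi; exact: iota_uniq.
have psi_lt e : e \in cut g X -> psi e < #|cut g X|.
  have [_ eq_psi] := uniq_min_size (iota_uniq _ _) sub_psi le_psi.
  by move=> eX; have := image_f psi eX; rewrite -eq_psi mem_iota add0n.
(* [r e] is the cut edge on the path that contains [e]; an edge inside [X] inherits the [phi]-colour
   of that cut edge. *)
pose r e := odflt e [pick f in cut g X | psi f == psi e].
have rP e f : f \in cut g X -> psi f = psi e -> r e = f.
  move=> fX eq_f; rewrite /r; case: pickP => [f' /andP[f'X /eqP eq_f']|/(_ f)].
    by apply: psi_inj; rewrite // eq_f'.
  by rewrite fX eq_f eqxx.
pose inside e := ((g e).1 \in X) && ((g e).2 \in X).
apply/packsP; exists (fun e => phi (if inside e then r e else e)) => i Z lt_it.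
wlog xZ : Z / x \in Z => [IHZ|].
  case: (boolP (x \in Z)) => [/IHZ//|xZ]; rewrite -separatesC => sepZ.
  have [|e] := IHZ (~: Z) _ sepZ; first by rewrite inE.
  by rewrite cutC; exists e.
case/separatesP=> _ [z [_ zT _ zZ]].
have zX : z \notin X by apply: contraNN zZ => /(TX z zT)->.
pose good e := (e \in cut g Z) && (phi (if inside e then r e else e) == i).
case: (pickP good) => [e /andP[eZ /eqP phie]|bad]; first by exists e.
(* When no edge of colour [i] crosses [Z], the path from [x] through a cut edge of colour [i] cannot
   leave [Z], so the outer end of this edge is in [Z]. *)
have outer e : e \in cut g X -> phi e = i ->
    (if (g e).1 \in X then (g e).2 else (g e).1) \in Z.
  move=> eX phie; apply: contraFT (bad e) => eZ.
  have ZX : Z :&: X \subset X by exact: subsetIr.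
  have [|f] := psiP _ _ (psi_lt e eX) (sep2 _ ZX _); first by rewrite inE xZ.
  rewrite cut2 // => fZX psif; have Nbad := bad f.
  have in_e : inside e = false.
    by move: eX; rewrite /inside inE; do 2!case: (_ \in X).
  case: (boolP (f \in cut g X)) => [fX|fX].
    have ef : f = e by exact: psi_inj.
    rewrite /good in_e /= phie eqxx andbT; rewrite ef in fZX.
    move: eZ fZX eX; rewrite !inE; do 2!case: (_ \in X);
      do 2!case: (_ \in Z) => //.
  have in_f : inside f.
    move: fX fZX; rewrite /inside !inE; do 2!case: (_ \in X) => //;
     by rewrite !andbF.
  move: Nbad; rewrite /good in_f (rP f e) // phie eqxx andbT.
  move: fZX in_f; rewrite /inside !inE => fZX.
  by case/andP=> fX1 fX2; move: fZX; rewrite fX1 fX2 !andbT => ->.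
have cut1 : cut (contract X x g) (Z :|: X) = cut g (Z :|: X).
  rewrite cut_contract; congr (cut g _); apply/setP=> w; rewrite !inE.
  by case: (boolP (w \in X)) => [_|/negPf->] //; rewrite xX !orbT.
(* The edge [f] of colour [i] leaving [Z :|: X] either avoids [X] and crosses [Z], or has an outer
   end outside [Z], against [outer]. *)
have [|f] := phiP i (Z :|: X) lt_it.
  by apply/separatesP; exists x, z; rewrite !inE xX orbT negb_or zZ zX.
rewrite cut1 => fZX phif; have := bad f; rewrite /good /inside.
have := outer f; move: fZX; rewrite !inE.
case: (boolP ((g f).1 \in X)) => f1; case: (boolP ((g f).2 \in X)) => f2;
  rewrite ?orbT ?orbF //= phif eqxx andbT.
- by move=> f2Z /(_ isT erefl); move: f2Z; case: (_ \in Z).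
- by move=> f2Z /(_ isT erefl); move: f2Z; case: (_ \in Z).
- by move=> ->.
Qed.

End Multigraph.

(** * The edge version of Menger's theorem *)

Section EdgeMenger.
Variables V E : finType.
Implicit Types (g : E -> V * V) (T X Z : {set V}) (D : {set E}) (k t : nat).

Lemma packs0 g T : packs g T 0.
Proof. by apply/packsP; exists (fun=> 0). Qed.

Lemma separates2 x y Z : separates [set x; y] Z = ((x \in Z) != (y \in Z)).
Proof.
apply/separatesP/idP => [[a [b [/set2P[]-> /set2P[]-> -> /negPf->]]]|] //.
by case: (boolP (x \in Z)) => xZ; case: (boolP (y \in Z)) => yZ // _;
   [exists x, y | exists y, x]; rewrite !inE !eqxx orbT.
Qed.

Lemma cut_ends g Z e : e \in cut g Z ->
  exists u w, [/\ u \in Z, w \notin Z & e \in cut g [set u] :&: cut g [set w]].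
Proof.
rewrite inE => eZ; have ne : (g e).1 != (g e).2 by apply: contraNneq eZ => ->.
move: eZ; case: (boolP (_ \in Z)) => e1; case: (boolP (_ \in Z)) => e2 // _;
  [exists (g e).1, (g e).2 | exists (g e).2, (g e).1];
by split; rewrite // !inE !eqxx (eq_sym (g e).2) (negPf ne).
Qed.

(** Deleting one edge lowers a cut by at most one, so a cut that falls below [k] had exactly [k]
    edges, among them [e]. *)
Lemma critical_edge g T k e :
    edge_connected g T k -> ~~ edge_connected (delete [set e] g) T k ->
  exists Z, [/\ separates T Z, e \in cut g Z & #|cut g Z| = k].
Proof.
move=> /edge_connectedP gk; rewrite negb_forall => /existsP[Z].
rewrite negb_imply cut_delete -ltnNge => /andP[sepZ lt_k]; exists Z.
have := gk Z sepZ; move: lt_k; rewrite (cardsD1 e (cut g Z)).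
by case: (e \in _) => //=; split; lia.
Qed.

(** In a counterexample with fewest non-loops every edge is in a tight cut. If both sides contain
    edges, two smaller packings are glued; otherwise the cut is that of [x] or [y]. Once every edge
    is at [x] or [y], an edge [xy] is removed as a path, or a path [x u y] is split off at [u]. *)
Lemma menger x y g k :
  x != y -> edge_connected g [set x; y] k -> packs g [set x; y] k.
Proof.
move=> xy; have [n] := ubnP #|nonloops g|; elim: n => // n IHn in g k *.
rewrite ltnS => le_n gk; apply: contraT => no_pack; set T := [set x;
  y] in gk no_pack *.
have IH g' k' : #|nonloops g'| < #|nonloops g| ->
    edge_connected g' T k' -> packs g' T k'.
  by move=> lt_g'; apply: IHn; apply: leq_trans le_n.
have atT e : e \in nonloops g -> (e \in cut g [set x]) || (e \in cut g [set y]).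
  move=> eL; have /(critical_edge gk) : ~~ edge_connected
    (delete [set e] g) T k.
    apply: contra no_pack => /IH del; apply: packs_delete (del _).
    by apply: card_nonloops_delete eL _; rewrite inE.
  case=> Z0 [sepZ0 eZ0 cardZ0].
  have [Z [xZ yZ eZ cardZ]] :
      exists Z, [/\ x \in Z, y \notin Z, e \in cut g Z & #|cut g Z| = k].
    move: sepZ0; rewrite separates2; case: (boolP (x \in Z0)) => xZ; last first.
      rewrite eq_sym eqbF_neg negbK => yZ; exists (~: Z0).
      by split; rewrite ?cutC // inE ?negbK.
    by rewrite eq_sym eqb_id => yZ; exists Z0.
  have kx : k <= #|cut g [set x]|.
    by apply: (edge_connectedP _ _ _ gk);
      rewrite separates2 !inE eqxx (eq_sym y) (negPf xy).
  have ky : k <= #|cut g [set y]|.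
    by apply: (edge_connectedP _ _ _ gk);
      rewrite separates2 !inE eqxx (negPf xy).
  case: (boolP [exists e in nonloops g, ((g e).1 \in Z) && ((g e).2 \in Z)]).
    case/exists_inP=> e1 e1L /andP[e11 e12].
  case: (boolP [exists e
    in nonloops g, ((g e).1 \in ~: Z) && ((g e).2 \in ~: Z)]).
    case/exists_inP=> e2 e2L /andP[e21 e22].
    case/negP: no_pack; apply: (@packs_glue _ _ Z x y); rewrite ?inE ?eqxx //.
    - by move=> z /set2P[|->] //; rewrite (negPf yZ).
    - apply: IH; first exact: card_nonloops_contract e1L e11 e12.
      by apply: edge_connected_contract => // z /set2P[|->] //;
        rewrite (negPf yZ).
    - rewrite cardZ; apply: IH; first exact: card_nonloops_contract e2L e21 e22.
      by apply: edge_connected_contract; rewrite ?inE // => z /set2P[|] ->;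
        rewrite ?inE ?xZ.
  - move/cut_free => /(_ y); rewrite cutC inE cardZ => /(_ yZ ky) eqZ.
    by rewrite -eqZ eZ orbT.
  by move/cut_free => /(_ x); rewrite cardZ => /(_ xZ kx) eqZ; rewrite -eqZ eZ.
case: k => [|k] in gk no_pack *; first by rewrite packs0 in no_pack.
(* [Z] is [x] with its neighbours. If [y] is not one, some edge leaves [Z]; it is not at [x], so it
   joins a neighbour [u] of [x] to [y]. *)
pose Z := [set z |
  (z == x) || [exists e, e \in cut g [set x] :&: cut g [set z]]].
have xZ : x \in Z by rewrite inE eqxx.
case: (boolP (y \in Z)) => yZ.
  move: yZ; rewrite inE eq_sym (negPf xy) /= => /existsP[e exy].
  have eL := subsetP (cut_nonloops g _) e (proj1 (setIP exy)).
  case/negP: no_pack; apply: (@packs_add_tree _ _ [set e]).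
    move=> Z'; rewrite separates2 => sepZ'; exists e; first by rewrite inE.
    by rewrite (cut_between _ xy exy).
  apply: IH; first by apply: card_nonloops_delete eL _; rewrite inE.
  apply/edge_connectedP => Z' sepZ'; rewrite cut_delete.
  by have := edge_connectedP _ _ _ gk _ sepZ'; rewrite (cardsD1 e);
    case: (e \in _); lia.
have /(edge_connectedP _ _ _ gk) : separates T Z by rewrite separates2 xZ.
case/(leq_trans (ltn0Sn k))/card_gt0P=> f fZ.
have fL := subsetP (cut_nonloops g _) f fZ.
have [u [w [uZ wZ fuw]]] := cut_ends fZ.
have wx : w != x by apply: contraNneq wZ => ->.
have uw : u != w by apply: contraNneq wZ => <-.
have ux : u != x.
  apply: contraNneq wZ => ux; rewrite ux in fuw.
  by rewrite inE (negPf wx); apply/existsP; exists f.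
have fx : f \notin cut g [set x].
  by rewrite (cut_between _ uw fuw) !inE (negPf ux) (negPf wx).
have wy : w = y.
  have := atT f fL; rewrite (negPf fx) (cut_between _ uw fuw) !inE.
  have [uy|_] := eqVneq u y; first by rewrite -uy uZ in yZ.
  by case: (eqVneq w y).
rewrite {w wZ}wy in fuw wx uw.
move: uZ; rewrite inE (negPf ux) => /existsP[e exu]; rewrite setIC in exu.
have ef : e != f by apply: contraNneq fx => <-; case/setIP: exu.
case/negP: no_pack; apply: (packs_split_off exu fuw ux uw).
apply: IH; first exact: card_nonloops_split_off exu fuw ef.
(* Splitting off lowers only cuts that keep [x] and [y] together. *)
apply/edge_connectedP => Z' sepZ'.
have := edge_connectedP _ _ _ gk _ sepZ'.
rewrite (card_cut_split_off Z' exu fuw ef ux uw).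
by move: sepZ'; rewrite separates2; case: (_ == _); rewrite // addn0.
Qed.

End EdgeMenger.

(** * Packing trees on three terminals in a multigraph *)

Section ThreeTerminals.
Variables V E : finType.
Implicit Types (g : E -> V * V) (T X Z : {set V}) (D : {set E}) (k t : nat).

Definition between g x y : {set E} := cut g [set x] :&: cut g [set y].

Lemma betweenC g x y : between g x y = between g y x.
Proof. exact: setIC. Qed.

Lemma between_notin g x y z e :
  x != y -> x != z -> y != z -> e \in between g x y -> e \notin cut g [set z].
Proof.
by move=> xy xz yz exy;
  rewrite (cut_between _ xy exy) !inE (negPf xz) (negPf yz).
Qed.

(** The cut of the union is the symmetric difference of the two cuts. *)
Lemma card_cut_setU1 g v X : v \notin X ->
  #|cut g (v |: X)| + #|cut g [set v] :&: cut g X|.*2 =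
  #|cut g [set v]| + #|cut g X|.
Proof.
move=> vX; set A := cut g [set v]; set B := cut g X.
have -> : cut g (v |: X) = (A :\: B) :|: (B :\: A).
  apply/setP=> e; rewrite !inE.
  have [->|_] := eqVneq (g e).1 v; have [->|_] := eqVneq (g e).2 v;
    rewrite ?(negPf vX) //=; by case: (_ \in X) => //; case: (_ \in X).
rewrite cardsU (_ : _ :&: _ = set0) ?cards0; last first.
  by apply/setP=> e; rewrite in_setI !in_setD in_set0; case: (e \in A);
    rewrite /= ?andbF.
have := cardsID B A; have := cardsID A B; rewrite (setIC B); lia.
Qed.

Lemma between_disjoint g v x y :
  v != x -> v != y -> x != y -> between g v x :&: between g v y = set0.
Proof.
move=> vx vy xy; apply/setP=> e; rewrite !in_setI in_set0.
case: (boolP (e \in between g v x)) => [evx|];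
  last by rewrite in_setI => /negPf->.
by rewrite (negPf (between_notin vx vy xy evx)) !andbF.
Qed.

Lemma card_cut_between2 g v x y :
    x != y -> v != x -> v != y ->
    cut g [set v] \subset cut g [set x] :|: cut g [set y] ->
  #|cut g [set v]| = #|between g v x| + #|between g v y|.
Proof.
move=> xy vx vy /setIidPl sub_v; rewrite -{1}sub_v setIUr.
by rewrite cardsU between_disjoint // cards0 subn0.
Qed.

Lemma card_cut_between3 g v x y z :
    x != y -> y != z -> x != z -> v != x -> v != y -> v != z ->
    cut g [set v] \subset cut g [set x] :|: cut g [set y] :|: cut g [set z] ->
  #|cut g [set v]| = #|between g v x| + #|between g v y| + #|between g v z|.
Proof.
move=> xy yz xz vx vy vz /setIidPl sub_v; rewrite -{1}sub_v 2!setIUr.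
rewrite cardsU setIUl !between_disjoint // setU0 cards0 subn0.
by rewrite cardsU between_disjoint // cards0 subn0.
Qed.

Definition triple T x y z := [/\ T = [set x; y; z], x != y, y != z & x != z].

Lemma triple_swap12 T x y z : triple T x y z -> triple T y x z.
Proof.
by case=> -> xy yz xz; split; rewrite // 1?eq_sym //; apply/setP=> u;
  rewrite !inE (orbC (u == x)).
Qed.

Lemma triple_swap23 T x y z : triple T x y z -> triple T x z y.
Proof.
by case=> -> xy yz xz; split; rewrite // 1?eq_sym //; apply/setP=> u;
  rewrite !inE orbAC.
Qed.

Lemma mem_triple T x y z : triple T x y z -> x \in T.
Proof. by case=> -> _ _ _; rewrite !inE eqxx. Qed.

Lemma separates3 T x y z Z : triple T x y z ->
  separates T Z = ((x \in Z) != (y \in Z)) || ((y \in Z) != (z \in Z)).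
Proof.
case=> -> _ _ _; apply/separatesP/idP.
  case=> u [w [uT wT uZ wZ]]; move: uT wT uZ wZ; rewrite !inE.
  by case/orP=> [/orP[]|] /eqP->; case/orP=> [/orP[]|] /eqP->;
    case: (x \in Z); case: (y \in Z); case: (z \in Z).
case/orP.
  case: (boolP (x \in Z)) => xZ; case: (boolP (y \in Z)) => yZ // _;
    [exists x, y | exists y, x]; by rewrite !inE !eqxx !orbT.
case: (boolP (y \in Z)) => yZ; case: (boolP (z \in Z)) => zZ // _;
  [exists y, z | exists z, y]; by rewrite !inE !eqxx !orbT.
Qed.

Lemma separates3_isolates T a b c Z : triple T a b c -> separates T Z ->
  exists x y z Z', [/\ triple T x y z, [&& x \in Z', y \notin Z' & z \notin Z']
                     & Z' = Z \/ Z' = ~: Z].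
Proof.
move=> abc; rewrite (separates3 _ abc).
have bac := triple_swap12 abc; have cab := triple_swap12 (triple_swap23 abc).
case: (boolP (a \in Z)) => aZ; case: (boolP (b \in Z)) => bZ;
  case: (boolP (c \in Z)) => cZ // _.
- by exists c, a, b, (~: Z); rewrite !inE aZ bZ cZ; split; auto.
- by exists b, a, c, (~: Z); rewrite !inE aZ bZ cZ; split; auto.
- by exists a, b, c, Z; rewrite aZ bZ cZ; split; auto.
- by exists a, b, c, (~: Z); rewrite !inE aZ bZ cZ; split; auto.
- by exists b, a, c, Z; rewrite aZ bZ cZ; split; auto.
- by exists c, a, b, Z; rewrite aZ bZ cZ; split; auto.
Qed.

Lemma packs_add_path T x y z g t e f :
    triple T x y z -> e \in between g y x -> f \in between g y z ->
  packs (delete [set e; f] g) T t -> packs g T t.+1.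
Proof.
move=> xyz; have [_ xy yz _] := xyz; rewrite (betweenC g y x) => exy fyz.
apply: packs_add_tree => Z; rewrite (separates3 _ xyz).
case/orP=> sepZ; [exists e | exists f]; rewrite ?in_set2 ?eqxx ?orbT //.
  by rewrite (cut_between _ xy exy).
by rewrite (cut_between _ yz fyz).
Qed.

Lemma card_setD2 (A : {set E}) e f : e != f ->
  #|A :\: [set e; f]| = #|A| - (e \in A) - (f \in A).
Proof.
move=> ef; rewrite (cardsD1 e A) (cardsD1 f (A :\ e)) !inE eq_sym ef.
by rewrite setDDl /= addKn addKn.
Qed.

(** Greedy choice: a path with one edge from each of the two largest classes. Removing it preserves
    the four inequalities with [t] lowered by one. *)
Lemma packs_triangle T x y z g t :
    triple T x y z -> t <= #|between g x y| + #|between g y z| ->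
    t <= #|between g x y| + #|between g x z| ->
    t <= #|between g y z| + #|between g x z| ->
    t.*2 <= #|between g x y| + #|between g y z| + #|between g x z| ->
  packs g T t.
Proof.
elim: t => [|t IHt] in x y z g *; first by rewrite packs0.
wlog: x y z / (#|between g x z| <= #|between g x y|) &&
              (#|between g x z| <= #|between g y z|).
  move=> IHw xyz h1 h2 h3 h4.
  have c1 := betweenC g x y; have c2 := betweenC g y z.
  have := IHw x y z; have := IHw y x z; have := IHw x z y.
  have yxz := triple_swap12 xyz; have xzy := triple_swap23 xyz.
  move: h1 h2 h3 h4; rewrite -c1 -c2; clear IHw IHt c1 c2.
  move: #|between g x y| #|between g y z| #|between g x z| => p q r.
  move=> h1 h2 h3 h4 i1 i2 i3.
  case: (leqP r p) => rp; case: (leqP r q) => rq; case: (leqP p q) => pq;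
   by [apply: i3 => //; lia | apply: i1 => //; lia | apply: i2 => //; lia].
case/andP=> rp rq xyz h1 h2 h3 h4; have [_ xy yz xz] := xyz.
have /card_gt0P[e eyx] : 0 < #|between g y x| by rewrite betweenC; lia.
have /card_gt0P[f fyz] : 0 < #|between g y z| by lia.
apply: (packs_add_path xyz eyx fyz).
have [yx zy zx] : [/\ y != x, z != y & z != x] by rewrite !(eq_sym z) eq_sym.
have ez : e \notin cut g [set z] by exact: between_notin eyx.
have fx : f \notin cut g [set x] by exact: between_notin fyz.
have ef : e != f by apply: contraNneq ez => ->; case/setIP: fyz.
have card_del u w : #|between (delete [set e; f] g) u w| =
    #|between g u w| - (e \in between g u w) - (f \in between g u w).
  by rewrite -card_setD2 // /between !cut_delete -setDIl.
have exz : e \in between g x z = false by rewrite in_setI (negPf ez) andbF.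
have eyz : e \in between g y z = false by rewrite in_setI (negPf ez) andbF.
have fxz : f \in between g x z = false by rewrite in_setI (negPf fx).
have fxy : f \in between g x y = false by rewrite in_setI (negPf fx).
rewrite betweenC in eyx.
have IH := IHt x y z (delete [set e; f] g) xyz.
rewrite !card_del exz fxz eyz fyz eyx fxy /= in IH.
move: h1 h2 h3 h4 rp rq IH; clear.
move: #|between g x y| #|between g y z| #|between g x z| => p q r.
by move=> h1 h2 h3 h4 rp rq; apply; lia.
Qed.

Lemma three_terminal_packing T a b c g k :
  triple T a b c -> edge_connected g T k -> packs g T (uphalf (3 * k))./2.
Proof.
move=> abc; have [n] := ubnP #|nonloops g|; elim: n => // n IHn in g k *.
rewrite ltnS => le_n gk; apply: contraT => no_pack.
have IH g' k' : #|nonloops g'| < #|nonloops g| ->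
    edge_connected g' T k' -> packs g' T (uphalf (3 * k'))./2.
  by move=> lt_g'; apply: IHn; apply: leq_trans le_n.
have gkT x y z Z : triple T x y z -> x \in Z -> y \notin Z -> z \notin Z ->
    k <= #|cut g Z|.
  move=> xyz xZ yZ zZ; apply: (edge_connectedP _ _ _ gk).
  by rewrite (separates3 _ xyz) xZ (negPf yZ).
have tight_free x y z X e0 : triple T x y z ->
    x \in X -> y \notin X -> z \notin X -> e0 \in nonloops g ->
    (g e0).1 \in X -> (g e0).2 \in X -> k < #|cut g X|.
  move=> xyz xX yX zX e0L e01 e02; rewrite ltnNge;
    apply: contra no_pack => leXk.
  have cardX : #|cut g X| = k by apply/eqP; rewrite eqn_leq leXk (gkT x y z).
  have TX u : u \in T -> u \in X -> u = x.
    have [-> _ _ _] := xyz; rewrite !inE => /orP[/orP[]|] /eqP-> //.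
      by rewrite (negPf yX).
    by rewrite (negPf zX).
  apply: (@packs_glue _ _ X x y) => //; first exact: mem_triple xyz.
    apply: IH; first exact: card_nonloops_contract e0L e01 e02.
    exact: edge_connected_contract.
  rewrite cardX; apply: menger; first by case: xyz.
  apply: edge_connected_contract; rewrite ?in_setC //.
    by move=> u /set2P[|] ->; rewrite ?in_setC ?xX.
  (* Menger concerns only sets separating [x] from [y], and these separate [T]. *)
  apply/edge_connectedP => Z; rewrite separates2 => sepZ;
    apply: edge_connectedP gk _ _.
  rewrite (separates3 _ xyz); case: eqP sepZ => //.
(* The tight cut of a critical edge has no edge inside by [tight_free], so it equals the cut of its
   single terminal. *)
have tight_end e : e \in nonloops g ->
    exists x, [/\ x \in T, #|cut g [set x]| = k & e \in cut g [set x]].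
  move=> eL; have /(critical_edge gk) :
      ~~ edge_connected (delete [set e] g) T k.
    apply: contra no_pack => /IH del; apply: packs_delete (del _).
    by apply: card_nonloops_delete eL _; rewrite inE.
  case=> Z0 [sepZ0 eZ0 cardZ0].
  have [x [y [z [Z [xyz /and3P[xZ yZ zZ] defZ]]]]] := separates3_isolates abc
    sepZ0.
  have [eZ cardZ] : e \in cut g Z /\ #|cut g Z| = k.
    by case: defZ => ->; rewrite ?cutC.
  have [_ xy _ xz] := xyz.
  have /(cut_free xZ) : ~~ [exists e
    in nonloops g, ((g e).1 \in Z) && ((g e).2 \in Z)].
    apply/exists_inP => -[e0 e0L /andP[e01 e02]].
    by have := tight_free _ _ _ _ _ xyz xZ yZ zZ e0L e01 e02;
      rewrite cardZ ltnn.
  rewrite cardZ (gkT x y z) ?inE // 1?eq_sym // => /(_ isT) eqZ.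
  by exists x; rewrite -eqZ (mem_triple xyz) cardZ eZ.
have deg_v v x y z : v \notin T -> triple T x y z ->
    #|cut g [set v]| = #|between g v x| + #|between g v y| + #|between g v z|.
  move=> vT xyz; have [defT xy yz xz] := xyz.
  have [vx vy vz] : [/\ v != x, v != y & v != z].
    by move: vT; rewrite defT !inE !negb_or -andbA => /and3P.
  apply: card_cut_between3 => //; apply/subsetP=> e ev.
  have [u [uT _ eu]] := tight_end e (subsetP (cut_nonloops _ _) e ev).
  move: uT eu; rewrite !in_setU defT !in_setU !in_set1.
  by case/orP=> [/orP[]|] /eqP-> ->; rewrite ?orbT.
(* With [p] edges [vx] and [d] the degree of [v], the cut of [{x, v}] has [k + d - 2 p] edges. It
   has the edge [e] inside, so [tight_free] gives [2 p < d]. *)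
have at_terminal v x y z e : v \notin T -> triple T x y z ->
  e \in between g v x ->
    #|cut g [set x]| = k /\ #|between g v x|.*2 < #|cut g [set v]|.
  move=> vT xyz evx; have [defT xy yz xz] := xyz.
  have [vx vy vz] : [/\ v != x, v != y & v != z].
    by move: vT; rewrite defT !inE !negb_or -andbA => /and3P.
  have eL : e \in nonloops g by apply: (subsetP (cut_nonloops g [set v]));
    case/setIP: evx.
  have [u [uT cardu eu]] := tight_end e eL.
  have ux : u = x.
    move: eu; rewrite (cut_between _ vx evx) !inE.
    have -> : v == u = false by apply: contraNF vT => /eqP->.
    by case: (eqVneq x u).
  rewrite ux in cardu; split => //.
  have xvX : x \notin [set v] by rewrite inE eq_sym.
  have e_in : ((g e).1 \in x |: [set v]) && ((g e).2 \in x |: [set v]).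
    move: evx; rewrite !inE; case: (eqVneq (g e).1 v) => [->|_] /=.
      by rewrite (negPf vx) /=; case: (_ == v); case: (_ == x).
    case: (eqVneq (g e).2 v) => [->|_] //=; rewrite (negPf vx).
    by case: (_ == x).
  case/andP: e_in => e1 e2; have := tight_free x y z (x |: [set v]) e xyz.
  have [xy' xz'] : y != x /\ z != x by rewrite eq_sym xy eq_sym.
  rewrite !in_setU1 !in_set1 eqxx (negPf xy') (negPf xz').
  rewrite (eq_sym y v) (eq_sym z v) (negPf vy) (negPf vz).
  rewrite !in_setU1 !in_set1 in e1 e2; move=> /(_ isT isT isT eL e1 e2).
  have := card_cut_setU1 g xvX; rewrite cardu -/(between g x v) betweenC.
  by clear; move: #|_| #|_| #|_| => p q r; lia.
have to_side v x y z Z : v \notin T -> triple T x y z -> y \notin Z ->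
    z \notin Z -> v \notin Z ->
    #|cut g [set v] :&: cut g Z| <= #|between g v x|.
  move=> vT [defT _ _ _] yZ zZ vZ.
  apply: subset_leq_card; apply/subsetP => e /setIP[ev eZ];
    rewrite in_setI ev /=.
  have [u [uT _ eu]] := tight_end e (subsetP (cut_nonloops _ _) e ev).
  have vu : v != u by apply: contraNneq vT => ->.
  have evu : e \in between g v u by rewrite in_setI ev.
  move: eZ; rewrite (cut_between _ vu evu) (negPf vZ) => uZ.
  suff -> : x = u by [].
  move: uZ uT; rewrite defT !inE.
  case: (eqVneq x u) => [//|ux]; case: (eqVneq u y) => [->|_].
    by rewrite (negPf yZ).
  by case: (eqVneq u z) => [->|_]; rewrite ?(negPf zZ).
(* Moving [v] out of [Z] adds at most [2 p - d] edges to the cut, with [p] edges [vx] and [d] the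
   degree of [v], and at least [k] must remain. *)
have moved v x y z Z : v \notin T -> triple T x y z ->
    x \in Z -> y \notin Z -> z \notin Z -> v \in Z ->
    k + #|cut g [set v]| <= #|cut g Z| + #|between g v x|.*2.
  move=> vT xyz xZ yZ zZ vZ.
  have vx : v != x by apply: contraNneq vT => ->; apply: mem_triple xyz.
  have vZv : v \notin Z :\ v by rewrite !inE eqxx.
  have [yZv zZv] : y \notin Z :\ v /\ z \notin Z :\ v.
    by rewrite !in_setD1 (negPf yZ) (negPf zZ) !andbF.
  have := card_cut_setU1 g vZv; rewrite setD1K //.
  have : k <= #|cut g (Z :\ v)|.
    by apply: (gkT x y z); rewrite // in_setD1 xZ eq_sym vx.
  have := to_side v x y z (Z :\ v) vT xyz yZv zZv vZv; clear.
  by move: #|_| #|_| #|_| #|_| #|_| => p q r s t; lia.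
(* Splitting off [vx] and [vy] costs two only in a cut with [v] and [z] against [x] and [y]; by
   [moved] and the bound on the edges [vz], such a cut has at least [k + 2] edges. *)
have no_split v x y z : v \notin T -> triple T x y z ->
    0 < #|between g v x| -> 0 < #|between g v y| ->
    #|between g v z|.*2.+1 < #|cut g [set v]| -> False.
  move=> vT xyz /card_gt0P[e evx] /card_gt0P[f fvy] lt_z; case/negP: no_pack.
  have [defT xy yz xz] := xyz.
  have [vx vy vz] : [/\ v != x, v != y & v != z].
    by move: vT; rewrite defT !inE !negb_or -andbA => /and3P.
  have ef : e != f.
    apply: contraNneq (between_notin vx vy xy evx) => ->.
    by case/setIP: fvy.
  apply: (packs_split_off evx fvy vx vy); apply: IH.
    exact: card_nonloops_split_off evx fvy ef.
  apply/edge_connectedP => Z sepZ; have := edge_connectedP _ _ _ gk Z sepZ.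
  have := card_cut_split_off Z evx fvy ef vx vy.
  move: sepZ; rewrite (separates3 _ xyz) => sepZ.
  case: eqP => [eq_xy|_] /=; last by rewrite addn0 => ->.
  case: eqP => [_|/eqP neq_vx] /=; first by rewrite addn0 => ->.
  move=> cardZ _; rewrite -(leq_add2r 2) -cardZ.
  have zxy : triple T z x y by exact/triple_swap12/triple_swap23.
  have [Z' [zZ' xZ' yZ' vZ' <-]] : exists Z', [/\ z \in Z', x \notin Z',
      y \notin Z', v \in Z' & cut g Z' = cut g Z].
    case: (boolP (z \in Z)) => zZ; [exists Z | exists (~: Z)];
      rewrite ?cutC ?in_setC; move: sepZ neq_vx zZ;
      rewrite eq_xy; case: (y \in Z); case: (v \in Z); case: (z \in Z) => //.
  have := moved v z x y Z' vT zxy zZ' xZ' yZ' vZ'; move: lt_z; clear.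
  by move: #|_| #|_| #|_| => p q r; lia.
case: (boolP [exists v in ~: T, cut g [set v] != set0]) => [/exists_inP[v]|].
  rewrite inE -card_gt0 => vT deg_gt0.
  have bac := triple_swap12 abc; have cab := triple_swap12 (triple_swap23 abc).
  have lt_deg x y z : triple T x y z -> 0 < #|between g v x| ->
      #|cut g [set x]| = k /\ #|between g v x|.*2 < #|cut g [set v]|.
    by move=> xyz /card_gt0P[e evx]; exact: at_terminal vT xyz evx.
  have [_ ab bc ac] := abc.
  have [va vb vc] : [/\ v != a, v != b & v != c].
    by move: vT; have [-> _ _ _] := abc; rewrite !inE !negb_or -andbA => /and3P.
  have := deg_v v a b c vT abc.
  have := lt_deg a b c abc; have := lt_deg b a c bac; have := lt_deg c a b cab.
  have := no_split v a b c vT abc;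
    have := no_split v a c b vT (triple_swap23 abc).
  have := no_split v b c a vT (triple_swap23 bac).
  move=> na nb nc lc lb la degv.
  (* Let [p], [q], [r] be the multiplicities. The strict triangle inequalities make all of them
     positive; then [no_split] gives [p + q <= r + 1] and its permutations, and adding two of these
     bounds each multiplicity by 1. *)
  have [a1 [b1 [c1 degv3]]] : #|between g v a| = 1 /\ #|between g v b| = 1 /\
      #|between g v c| = 1 /\ #|cut g [set v]| = 3.
    move: na nb nc la lb lc degv deg_gt0; clear.
    move: #|cut g [set v]| #|between g v a| #|between g v b| #|between g v c|.
    move: #|cut g _| #|cut g _| #|cut g _| => da db dc d p q r.
    by lia.
  have mult1 x y z : triple T x y z -> #|between g v x| = 1.
    case=> defT _ _ _; have [defT' _ _ _] := abc.
    have : x \in T by rewrite defT !inE eqxx.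
    by rewrite defT' !inE => /orP[/orP[]|] /eqP->.
  have k_gt0 : 0 < k.
    have [|<- _] := la; first by rewrite a1.
    by rewrite -a1; apply/subset_leq_card/subsetIr.
  (* The bound grows by at most one from [k - 1] to [k], so the star of [v] pays for the loss of one
     in [k]. *)
  case/negP: no_pack; apply: (@packs_leq _ _ _ _ _ (uphalf (3 * k.-1))./2.+1).
    by move: k_gt0; clear; case: k => // k _; lia.
  apply: (@packs_add_tree _ _ (cut g [set v])).
    have star x y z Z : triple T x y z -> (v \in Z) != (x \in Z) ->
        exists2 e, e \in cut g [set v] & e \in cut g Z.
      move=> xyz vxZ; have /card_gt0P[e evx] : 0 < #|between g v x|.
        by rewrite (mult1 x y z).
      have vx : v != x by apply: contraNneq vxZ => ->.
      by exists e; [case/setIP: evx | rewrite (cut_between _ vx evx)].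
    move=> Z; rewrite (separates3 _ abc) => sepZ.
    case: (boolP ((v \in Z) == (a \in Z))) => [vaZ|]; last exact: star abc.
    case: (boolP ((v \in Z) == (b \in Z))) => [vbZ|]; last exact: star bac.
    apply: star cab _; move: sepZ vaZ vbZ.
    by case: (a \in Z); case: (b \in Z); case: (c \in Z); case: (v \in Z).
  apply: IH.
    have /card_gt0P[e ev] := deg_gt0.
    by apply: card_nonloops_delete (subsetP (cut_nonloops _ _) e ev) ev.
  apply/edge_connectedP => Z /(separates3_isolates abc).
  case=> x [y [z [Z' [xyz /and3P[xZ yZ zZ] defZ]]]].
  rewrite cut_delete -(_ : cut g Z' = cut g Z); last by case: defZ => ->;
    rewrite ?cutC.
  (* With its star deleted [v] is isolated and may be put outside [Z']; then the edge [vx] is the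
     only edge of the star that can cross. *)
  have -> : cut g Z' :\: cut g [set v] = cut g (Z' :\ v) :\: cut g [set v].
    apply/setP=> e; rewrite !inE; case: (eqVneq (g e).1 v) => [->|_] /=.
      by case: (eqVneq (g e).2 v) => [->|_]; rewrite ?eqxx.
    by case: (eqVneq (g e).2 v).
  have vx : v != x by apply: contraNneq vT => ->; apply: mem_triple xyz.
  have vZv : v \notin Z' :\ v by rewrite !inE eqxx.
  have [yZv zZv] : y \notin Z' :\ v /\ z \notin Z' :\ v.
    by rewrite !in_setD1 (negPf yZ) (negPf zZ) !andbF.
  have := to_side v x y z (Z' :\ v) vT xyz yZv zZv vZv.
  rewrite cardsD (mult1 x y z) // setIC.
  have : k <= #|cut g (Z' :\ v)|.
    by apply: (gkT x y z); rewrite // in_setD1 xZ eq_sym vx.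
  clear; move: #|_| #|_| => p q; lia.
rewrite negb_exists_in => /forall_inP no_inner.
have in_T e u : e \in cut g [set u] -> u \in T.
  move=> eu; apply: contraTT isT => uT; have := no_inner u.
  by rewrite inE uT negbK => /(_ isT) /eqP cut0; rewrite cut0 inE in eu.
have deg x y z : triple T x y z ->
    k <= #|between g x y| + #|between g x z|.
  move=> xyz; have [defT xy yz xz] := xyz.
  rewrite -card_cut_between2 //.
    by apply: (gkT x y z); rewrite // !inE // eq_sym.
  apply/subsetP=> e ex; have [u [w]] := cut_ends ex.
  rewrite inE => -[/eqP-> wx /setIP[_ ew]].
  have := in_T e w ew; rewrite defT in_set1 in wx *;
    rewrite !in_setU !in_set1 (negPf wx) /=.
  by case/orP=> /eqP <-; rewrite ew ?orbT.
case/negP: no_pack; have := deg a b c abc;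
  have := deg b a c (triple_swap12 abc).
have := deg c a b (triple_swap12 (triple_swap23 abc)).
rewrite (betweenC g b a) (betweenC g c a) (betweenC g c b) => hc hb ha.
(* The three degrees add up to twice the number of edges, which is therefore at least
   [uphalf (3 * k)]. *)
apply: (packs_triangle abc); move: hc hb ha; clear;
move: #|between g a b| #|between g b c| #|between g a c| => p q r; lia.
Qed.

End ThreeTerminals.

(** * Trees inside edge sets that cross all separating sets *)

Section LinkingTrees.
Variable V : finType.
Implicit Types (S Z A : {set V}) (F : {set {set V}}).

(** For a set [F] of pairs, the cut form of [S] lying in one component of [F]. *)
Definition links S F : bool :=
  [forall Z : {set V}, separates S Z ==> [exists e in F, separates e Z]].

Lemma linksP S F :
  reflect (forall Z, separates S Z -> exists2 e, e \in F & separates e Z)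
          (links S F).
Proof.
apply: (iffP forallP) => [linkF Z sepZ | linkF Z].
  by have /implyP/(_ sepZ)/exists_inP := linkF Z.
by apply/implyP=> /linkF/exists_inP.
Qed.

Lemma edge_rel_sym F : symmetric (edge_rel F).
Proof. by move=> x y; rewrite /edge_rel setUC. Qed.

Lemma connected_graph_links A F S :
  connected_graph A F -> S \subset A -> links S F.
Proof.
case/andP=> _ /forall_inP conF sSA; apply/linksP => Z.
case/separatesP=> x [y [xS yS xZ yZ]].
apply/exists_inP; apply: contraNT yZ;
  rewrite negb_exists_in => /forall_inP closedZ.
have /forall_inP/(_ y (subsetP sSA y yS)) := conF x (subsetP sSA x xS).
move/(closed_connect (a := Z)) => <- // u w uw.
by have := closedZ _ uw; rewrite separates2 negbK => /eqP.
Qed.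

Lemma links_connect F x y :
    (forall e, e \in F -> exists u w, e = [set u; w]) ->
  links [set x; y] F -> connect (edge_rel F) x y.
Proof.
move=> pairs /linksP linkF; apply: contraT => nxy.
have [|e eF] := linkF [set z | connect (edge_rel F) x z].
  by rewrite separates2 !inE connect0 (negPf nxy).
have [u [w eE]] := pairs e eF; rewrite eE separates2 !inE => /negP[]; apply/eqP.
have uw : edge_rel F u w by rewrite /edge_rel -eE.
apply/idP/idP => [xu|xw]; first exact: connect_trans xu (connect1 uw).
by apply: connect_trans xw (connect1 _); rewrite edge_rel_sym.
Qed.

(* A minimal edge set linking S is the edge set of a tree. *)
Lemma links_tree S F0 :
    S != set0 -> (forall e, e \in F0 -> exists u w, e = [set u;
      w]) -> links S F0 ->
  exists A F, [/\ F \subset F0, tree_graph A F, S \subset A &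
                  forall f, f \in F -> f \subset A].
Proof.
move=> /set0Pn[s sS] pairs0 /minset_exists[F /minsetP[linkF minF] sFF0].
have pairs e : e \in F -> exists u w, e = [set u; w].
  by move/(subsetP sFF0); apply: pairs0.
(* By minimality each edge [e] has a private cut: a set [Z] separating [S] that only [e] crosses. *)
have {}minF e : e \in F -> exists2 Z, separates S Z &
    forall f, f \in F -> separates f Z -> f = e.
  move=> eF; have : ~~ links S (F :\ e).
    apply: contraL eF => linkFe; rewrite -(minF _ linkFe (subsetDl _ _)).
    by rewrite !inE eqxx.
  rewrite negb_forall => /existsP[Z]; rewrite negb_imply negb_exists_in.
  case/andP=> sepZ /forall_inP noZ; exists Z => // f fF fZ; apply/eqP.
  by apply: contraLR fZ => fe; apply: noZ; rewrite !inE fe.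
exists (S :|: cover F), F; split=> //; last 2 first.
- exact: subsetUl.
- by move=> f fF; apply: subset_trans (subsetUr _ _); apply: bigcup_sup fF.
pose C := [set z | connect (edge_rel F) s z].
have closedC f : f \in F -> ~~ separates f C.
  move=> fF; have [u [w fE]] := pairs f fF; rewrite fE separates2 !inE negbK.
  have uw : edge_rel F u w by rewrite /edge_rel -fE.
  apply/eqP; apply/idP/idP => [xu|xw];
    first exact: connect_trans xu (connect1 uw).
  by apply: connect_trans xw (connect1 _); rewrite edge_rel_sym.
have sC : s \in C by rewrite inE connect0.
have sSC : S \subset C.
  apply/subsetP=> y yS; apply: contraT => yC.
  have [|e eF] := linksP _ _ linkF C; last by rewrite (negPf (closedC e eF)).
  by apply/separatesP; exists s, y.
(* [Z :&: C] still separates [S], so some edge crosses it. This edge lies in [C], hence crosses the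
   private cut of [f] and equals [f]. *)
have sFC f : f \in F -> f \subset C.
  move=> fF; have [Z sepZ onlyf] := minF f fF.
  have [|e eF sep_e] := linksP _ _ linkF (Z :&: C).
    case/separatesP: sepZ => x [y [xS yS xZ yZ]]; apply/separatesP; exists x, y.
    by rewrite !in_setI xZ (negPf yZ) (subsetP sSC).
  have [x [y [xe ye]]] := separatesP _ _ sep_e;
    rewrite !in_setI => /andP[xZ xC] yZC.
  have eC : e \subset C.
    have := closedC e eF; rewrite negb_and negbK negbK => /orP[|//].
    by move/pred0P/(_ x); rewrite /= xe xC.
  rewrite -(onlyf e eF) //; apply/separatesP; exists x, y; split=> //.
  by move: yZC; rewrite (subsetP eC y ye) andbT.
have sAC : S :|: cover F \subset C.
  by rewrite subUset sSC; apply/bigcupsP.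
apply/andP; split.
  apply/andP; split; first by apply/set0Pn; exists s; rewrite inE sS.
  apply/forall_inP=> x /(subsetP sAC) xC;
    apply/forall_inP=> y /(subsetP sAC) yC.
  rewrite !inE in xC yC; apply: connect_trans _ yC.
  by rewrite (sym_connect_sym (edge_rel_sym F)).
apply/forallP=> k; apply/forallP=> c; apply/implyP=> /andP[].
have := size_tuple c; case: (tval c) => [|x [|y [|w p]]] /= <- // cycle_c.
case/and3P=> x_notin y_notin uniq_p.
move: cycle_c; rewrite /= => /and3P[xy yw path_p].
(* The rest of the cycle leads from [y] back to [x] without crossing the private cut of [xy], a
   contradiction. *)
have [Z sepZ only_xy] := minF _ xy.
have /linksP/(_ Z sepZ)[e eF sep_e] := linkF.
have eE := only_xy e eF sep_e; rewrite eE separates2 in sep_e.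
case/negP: sep_e; apply/eqP; symmetry.
have side u v : u != x -> u != y -> edge_rel F u v -> (u \in Z) = (v \in Z).
  move=> ux uy uv; apply/eqP; rewrite -[_ == _]negbK -separates2.
  apply/negP=> /(only_xy _ uv)/setP/(_ u); rewrite !inE eqxx.
  by rewrite (negPf ux) (negPf uy).
have wx : w != x by apply: contraNneq x_notin => ->; rewrite !inE eqxx orbT.
have wy : w != y by apply: contraNneq y_notin => ->; rewrite !inE eqxx.
rewrite edge_rel_sym in yw; rewrite -(side w y) //.
elim: p w wx wy x_notin y_notin path_p {uniq_p yw} => [|v p IHp] w wx wy.
  by move=> _ _ /andP[wx' _]; apply: side.
rewrite !inE !negb_or => /and4P[xy' xw xv xp] /and3P[yw yv yp] /andP[wv path_p].
rewrite (side w v) //; apply: IHp; rewrite // 1?eq_sym // !inE !negb_or.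
  by rewrite xy' xv.
by rewrite yv.
Qed.

End LinkingTrees.

(** * Minima with a default value *)

Lemma bigminn_leq (I : finType) (P : pred I) (F : I -> nat) d i :
  P i -> \big[minn/d]_(j | P j) F j <= F i.
Proof.
move=> Pi; have := mem_index_enum i; elim: (index_enum I) => // j r IHr.
rewrite inE big_cons => /predU1P[<-|/IHr le_r]; first by rewrite Pi geq_minl.
by case: ifP => // _; rewrite geq_min le_r orbT.
Qed.

Lemma leq_bigminn (I : finType) (P : pred I) (F : I -> nat) d n :
  n <= d -> (forall j, P j -> n <= F j) -> n <= \big[minn/d]_(j | P j) F j.
Proof.
move=> le_nd le_nF; apply: (big_ind (fun m => n <= m)) => // m1 m2 le1 le2.
by rewrite leq_min le1.
Qed.

Lemma bigminn_leq_default (I : finType) (P : pred I) (F : I -> nat) d :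
  \big[minn/d]_(j | P j) F j <= d.
Proof.
elim/big_rec: _ => // i m _ le_m; exact: leq_trans (geq_minr _ _) le_m.
Qed.

(** * Simple graphs: boundaries, edge-connectivity and the lower bound *)

Section SimpleGraph.
Variable G : sgraph.
Implicit Types (S Z : {set G}) (F : {set {set G}}) (e : {set G}).

Definition boundary Z : {set {set G}} := [set e in edges G | separates e Z].

Lemma edgesP e :
  reflect (exists x y, adj x y /\ e = [set x; y]) (e \in edges G).
Proof.
apply: (iffP imsetP) => [[[x y]]|[x [y [xy ->]]]].
  by rewrite inE => xy ->; exists x, y.
by exists (x, y); rewrite ?inE.
Qed.

Lemma edges_pair F e : F \subset edges G -> e \in F ->
  exists u w, e = [set u; w].
Proof. by move=> /subsetP sF /sF/edgesP[u [w [_ ->]]]; exists u, w. Qed.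

(** Makes [G] a multigraph with edge type [{set G}]: sets that are not edges become loops at [x0],
    which lie in no cut. *)
Definition ends (x0 : G) e : G * G :=
  if [pick p : G * G | adj p.1 p.2 && (e == [set p.1; p.2])] is Some p
  then p else (x0, x0).

Lemma cut_ends_boundary x0 Z : cut (ends x0) Z = boundary Z.
Proof.
apply/setP=> e; rewrite !inE /ends.
case: pickP => [[x y] /= /andP[xy /eqP->] | nopair].
  rewrite separates2 (_ : _ \in edges G = true) //.
  by apply/edgesP; exists x, y.
rewrite eqxx /=; apply/esym/negbTE/negP => /andP[/edgesP[x [y [xy eE]]] _].
by have := nopair (x, y); rewrite /= xy eE eqxx.
Qed.

Lemma connected_boundary F : 0 < #|G| -> F \subset edges G ->
  connected_graph [set: G] F =
  [forall Z : {set G}, separates [set: G] Z ==> (boundary Z :&: F != set0)].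
Proof.
move=> G_gt0 sF; have /card_gt0P[x0 _] := G_gt0.
apply/idP/forallP => [conF Z|crossF].
  apply/implyP=> sepZ.
  have [e eF eZ] := linksP _ _ (connected_graph_links conF (subxx _)) Z sepZ.
  by apply/set0Pn; exists e; rewrite !inE (subsetP sF) ?eZ.
apply/andP; split; first by apply/set0Pn; exists x0.
apply/forall_inP=> x _; apply/forall_inP=> y _; apply: links_connect.
  by move=> e; apply: edges_pair.
apply/linksP => Z /separatesP[u [w [_ _ uZ wZ]]].
have /implyP/(_ _)/set0Pn[] := crossF Z.
  by apply/separatesP; exists u, w; rewrite !inE.
by move=> e; rewrite !inE => /andP[/andP[_ eZ] eF]; exists e.
Qed.

Lemma edge_connectivity_leq_boundary Z :
  separates [set: G] Z -> edge_connectivity G <= #|boundary Z|.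
Proof.
move=> sepZ; apply: bigminn_leq; have sub : boundary Z \subset edges G.
  by apply/subsetP=> e; rewrite inE => /andP[].
have [x [_ [_ _ _ _]]] := separatesP _ _ sepZ.
rewrite sub connected_boundary ?subsetDl //; last by apply/card_gt0P; exists x.
apply/forallPn; exists Z; rewrite negb_imply sepZ negbK.
by apply/eqP/setP=> e; rewrite !inE; case: (_ \in _); case: (separates e Z).
Qed.

Lemma leq_edge_connectivity n : 1 < #|G| ->
    (forall Z, separates [set: G] Z -> n <= #|boundary Z|) ->
  n <= edge_connectivity G.
Proof.
move=> G_gt1 leZ; have sub Z : boundary Z \subset edges G.
  by apply/subsetP=> e; rewrite inE => /andP[].
(* The default value is at least the boundary of a single vertex; a disconnecting [F] contains the
   boundary of some [Z]. *)
apply: leq_bigminn => [|F /andP[sF]].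
  have /card_gt1P[x [y [_ _ xy]]] := G_gt1.
  apply: leq_trans (leZ [set x] _) (subset_leq_card (sub _)).
  by apply/separatesP; exists x, y; rewrite !inE eqxx eq_sym.
rewrite connected_boundary ?subsetDl ?(ltnW G_gt1) // => /forallPn[Z].
rewrite negb_imply negbK => /andP[sepZ /eqP disjZ].
apply: leq_trans (leZ Z sepZ) (subset_leq_card _); apply/subsetP=> e eZ.
move/setP/(_ e): disjZ; rewrite in_setI eZ in_setD in_set0 (subsetP (sub Z)) //.
by rewrite andbT => /negbFE.
Qed.

Lemma connected_sgraph_edge_connectivity :
  1 < #|G| -> 0 < edge_connectivity G -> connected_sgraph G.
Proof.
move=> G_gt1 lam_gt0;
  rewrite /connected_sgraph connected_boundary ?(ltnW G_gt1) //.
apply/forallP=> Z; apply/implyP=> sepZ.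
rewrite (setIidPl _); last by apply/subsetP=> e; rewrite inE => /andP[].
by rewrite -card_gt0;
  apply: leq_trans lam_gt0 (edge_connectivity_leq_boundary sepZ).
Qed.

(** Each colour below [t] contains a tree connecting [S]. As [S] has two vertices each tree has an
    edge, so trees of different colours are distinct. *)
Lemma packs_local_lambda x0 S t :
  1 < #|S| -> packs (ends x0) S t -> t <= local_lambda S.
Proof.
move=> S_gt1 /packsP[phi phiP]; pose F i := [set e in edges G | phi e == i].
have /card_gt1P[a [b [aS bS ab]]] := S_gt1.
have sepa : separates S [set a].
  by apply/separatesP; exists a, b; rewrite !inE eqxx eq_sym.
have linkF i : i < t -> links S (F i).
  move=> lt_it; apply/linksP => Z sepZ; have [e] := phiP i Z lt_it sepZ.
  by rewrite cut_ends_boundary inE => /andP[eG eZ] phie; exists e;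
    rewrite // inE eG phie /=.
have sF i : F i \subset edges G by apply/subsetP=> e; rewrite inE => /andP[].
have /fin_all_exists[H HP] (i : 'I_t) : exists H, connecting_tree S H &&
  (H.2 \subset F i).
  have [||A [F' [sF' tree_F' sSA F'A]]] := links_tree _ _ (linkF i (ltn_ord i)).
  - by apply/set0Pn; exists a.
  - by move=> e; apply: edges_pair.
  exists (A, F');
    rewrite /connecting_tree /is_subgraph /= tree_F' sSA sF' !andbT.
  by rewrite (subset_trans sF' (sF i)); apply/forall_inP.
have edgeH i : exists2 e, e \in (H i).2 & phi e = i.
  have /andP[/and3P[_ /andP[conH _] sSH] sHF] := HP i.
  have [e eH _] := linksP _ _ (connected_graph_links conH sSH) _ sepa.
  by exists e => //; move/(subsetP sHF): eH; rewrite inE => /andP[_ /eqP].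
have disjH i j : i != j -> [disjoint (H i).2 & (H j).2].
  move=> ij; apply/pred0P=> e /=; apply/negbTE/negP => /andP[ei ej].
  have /andP[_ /subsetP/(_ e ei)] := HP i;
    have /andP[_ /subsetP/(_ e ej)] := HP j.
  rewrite !inE => /andP[_ /eqP->] /andP[_ /eqP/val_inj ji].
  by rewrite ji eqxx in ij.
have H_inj : injective H.
  move=> i j eqH; apply/eqP; apply: contraT => /disjH; rewrite eqH.
  by have [e ej _] := edgeH j => /pred0P/(_ e); rewrite /= ej.
rewrite -[t in t <= _]card_ord -(card_imset _ H_inj); apply: leq_bigmax_cond.
apply/andP; split; first by apply/forall_inP=> _ /imsetP[i _ ->];
  case/andP: (HP i).
apply/forall_inP=> _ /imsetP[i _ ->]; apply/forall_inP=> _ /imsetP[j _ ->].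
by apply/implyP=> Hij; apply: disjH; apply: contraNneq Hij => ->.
Qed.

Lemma lambda3_lower_bound :
  (uphalf (3 * edge_connectivity G))./2 <= lambda3 G.
Proof.
set lam := edge_connectivity G; apply: leq_bigminn => [|S cardS].
  (* The default [#|edges G|] is at least [lam], which is at least the bound. *)
  apply: leq_trans (bigminn_leq_default _ _ _ : lam <= _).
  by move: lam => k; lia.
have [a [b [c [S_E ab bc ac]]]] : exists a b c, triple S a b c.
  have /card_gt2P[a [b [c [[aS bS cS] [ab bc ca]]]]] : 2 < #|S|
    by rewrite (eqP cardS).
  exists a, b, c; split; rewrite // 1?eq_sym //; apply/esym/eqP.
  rewrite eqEcard (eqP cardS); apply/andP; split.
    by apply/subsetP=> x; rewrite !inE => /orP[/orP[]|] /eqP->.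
  by rewrite -setUA cardsU1 cards2 !inE negb_or ab bc eq_sym ca.
apply: (@packs_local_lambda a); first by rewrite (eqP cardS).
apply: (@three_terminal_packing _ _ S a b c) => //.
apply/edge_connectedP => Z sepZ; rewrite cut_ends_boundary.
apply: edge_connectivity_leq_boundary.
have [x [y [_ _ xZ yZ]]] := separatesP _ _ sepZ.
by apply/separatesP; exists x, y; rewrite !inE.
Qed.

End SimpleGraph.

(** * The extremal graph: three cliques joined by matchings *)

Section ThreeCliques.
Variable L : nat.

Let c0 : 'I_3 := ord0.
Let c1 : 'I_3 := Ordinal (isT : 1 < 3).
Let c2 : 'I_3 := ord_max.

(** With these sizes [c0] and [c1] are left by [L] matching edges each and [c2] by at least [L],
    while there are only [uphalf (3 * L)] in all. *)
Definition matching_size (i j : 'I_3) : nat :=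
  if (i == ord_max) || (j == ord_max) then uphalf L else L./2.

Definition cliques_adj : rel ('I_3 * 'I_L.+1) := fun x y =>
  if x.1 == y.1 then x.2 != y.2
  else (x.2 == y.2) && (x.2 < matching_size x.1 y.1).

Lemma cliques_adj_sym : symmetric cliques_adj.
Proof.
move=> x y; rewrite /cliques_adj eq_sym (eq_sym x.2) /matching_size orbC.
by case: ifP => // _; case: eqP => // ->.
Qed.

Lemma cliques_adj_irr : irreflexive cliques_adj.
Proof. by move=> x; rewrite /cliques_adj !eqxx. Qed.

Definition three_cliques := SGraph cliques_adj_sym cliques_adj_irr.
Local Notation G := three_cliques.

Definition clique (j : 'I_3) : {set G} := [set x : G | x.1 == j].

Definition matching_edge (i j : 'I_3) (u : nat) : {set G} :=
  [set ((i, inord u) : G); ((j, inord u) : G)].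

Lemma I3P (i : 'I_3) : [\/ i = c0, i = c1 | i = c2].
Proof.
by case: i => [[|[|[|//]]] lt_i];
  [constructor 1 | constructor 2 | constructor 3];
  apply: val_inj.
Qed.

Lemma boundary_clique j e : e \in boundary (clique j) ->
  exists i u, [/\ i != j, u < matching_size j i & e = matching_edge j i u].
Proof.
rewrite inE => /andP[/edgesP[x [y [xy ->]]]]; rewrite separates2 !inE.
wlog xj : x y xy / x.1 == j => [IHw|].
  case: (boolP (x.1 == j)) => [xj|xj]; first by move: (IHw x y xy xj);
    rewrite xj.
  case: (boolP (y.1 == j)) => // yj _; rewrite adj_sym in xy.
  rewrite setUC; by apply: (IHw _ _ xy yj); rewrite yj (negPf xj).
rewrite xj => yj; have {}yj : y.1 != j by case: (y.1 == j) yj.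
move: xy; rewrite /= /cliques_adj (eqP xj) eq_sym (negPf yj) =>
  /andP[/eqP xy lt_x].
exists y.1, x.2; split=> //; rewrite /matching_edge inord_val {2}xy.
by rewrite -{1}(eqP xj) -!surjective_pairing.
Qed.

Lemma matching_size_leq i j : matching_size i j <= L.
Proof. by rewrite /matching_size; case: ifP => _; clear; lia. Qed.

Lemma matching_edgeP i j u : i != j -> u < matching_size i j ->
  matching_edge i j u \in edges G.
Proof.
move=> ij lt_u; apply/edgesP; exists (i, inord u), (j, inord u); split=> //=.
rewrite /cliques_adj (negPf ij) eqxx /= inordK //.
exact: leq_trans lt_u (leqW (matching_size_leq i j)).
Qed.

Definition matching_edges i j : seq {set G} :=
  [seq matching_edge i j u | u <- iota 0 (matching_size i j)].

Lemma matching_edges_uniq i j j' : j != i -> j' != i -> j != j' ->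
  uniq (matching_edges i j ++ matching_edges i j').
Proof.
move=> ji ji' jj'.
have inj k l : {in iota 0 (matching_size k l) &, injective (matching_edge k l)}.
  move=> u w; rewrite !mem_iota !add0n => lt_u lt_w /setP/(_ (k, inord u)).
  rewrite !inE eqxx /= => /esym.
  have [lt_uL lt_wL] := (leq_trans lt_u (leqW (matching_size_leq k l)),
                         leq_trans lt_w (leqW (matching_size_leq k l))).
  by case/orP=> /eqP[] => [|_] /(congr1 val) /=; rewrite !inordK.
rewrite cat_uniq !map_inj_in_uniq ?iota_uniq //=; try exact: inj.
rewrite andbT; apply/hasPn => _ /mapP[w _ ->]; apply/mapP => -[u _].
move/setP/(_ (j', inord w)); rewrite !inE eqxx orbT /=.
by rewrite !xpair_eqE (negPf ji') (eq_sym j') (negPf jj').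
Qed.

(** If [Z] splits a clique, at least [L] edges of this clique cross. Otherwise [Z] is a union of
    cliques, and all matching edges at the clique alone on its side cross. *)
Lemma boundary_three_cliques (Z : {set G}) :
  separates [set: G] Z -> L <= #|boundary Z|.
Proof.
case/separatesP=> -[i u] [[j w] [_ _ iZ jZ]].
case: (boolP [exists k : 'I_3, exists p : 'I_L.+1, exists q : 'I_L.+1,
          ((k, p) \in Z) && ((k, q) \notin Z)]) => [|uniform].
  case/existsP=> k /existsP[p /existsP[q /andP[pZ qZ]]].
  (* Each vertex [l] is joined to [q] or [p], whichever is on the other side. [l = p] is left out
     since it repeats the edge [pq] given by [l = q]. *)
  pose f (l : 'I_L.+1) : {set G} :=
    if (k, l) \in Z then [set (k, l); (k, q)] else [set (k, l); (k, p)].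
  have f_inj : {in [set~ p] &, injective f}.
    move=> l m; rewrite !inE => lp mp; rewrite /f.
    case: (boolP ((k, l) \in Z)) => lZ; case: (boolP ((k, m) \in Z)) => mZ.
    - move/setP/(_ (k, l)); rewrite !inE !eqxx /= => /esym/orP[] /eqP[] // lq.
      by rewrite lq (negPf qZ) in lZ.
    - move/setP/(_ (k, l)); rewrite !inE !eqxx /= => /esym/orP[] /eqP[] // lE.
      by rewrite lE eqxx in lp.
    - move/setP/(_ (k, m)); rewrite !inE !eqxx /= => /orP[] /eqP[] // lE.
      by rewrite lE eqxx in mp.
    - move/setP/(_ (k, l)); rewrite !inE !eqxx /= => /esym/orP[] /eqP[] // lE.
      by rewrite lE eqxx in lp.
  have := card_in_imset f_inj; rewrite cardsC1 card_ord /= => card_f.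
  apply: leq_trans (eq_leq (esym card_f)) _; apply: subset_leq_card;
    apply/subsetP => e /imsetP[l].
  rewrite !inE => lp ->; rewrite /f; case: ifP => lZ; rewrite separates2 lZ.
    rewrite (negPf qZ) andbT; apply/edgesP; exists (k, l), (k, q); split=> //=.
    by rewrite /cliques_adj /= eqxx; apply: contraNneq qZ => <-.
  rewrite pZ andbT; apply/edgesP; exists (k, l), (k, p); split=> //=.
  by rewrite /cliques_adj /= eqxx.
have inZ k p q : ((k, p) \in Z) = ((k, q) \in Z).
  have half p' q' : (k, p') \in Z -> (k, q') \in Z.
    move=> pZ; apply: contraNT uniform => qZ; apply/existsP; exists k.
    by apply/existsP; exists p'; apply/existsP; exists q'; rewrite pZ.
  by apply/idP/idP; apply: half.
pose J k := (k, ord0) \in Z.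
have side k k' : k' != k -> J k != J k' ->
  {subset matching_edges k k' <= boundary Z}.
  move=> kk' Jkk' e /mapP[p]; rewrite mem_iota add0n => lt_p ->.
  by rewrite inE matching_edgeP // 1?eq_sym // separates2 !(inZ _ _ ord0).
have bound k k1 k2 : k1 != k -> k2 != k -> k1 != k2 -> J k != J k1 ->
  J k != J k2 ->
    L <= matching_size k k1 + matching_size k k2 -> L <= #|boundary Z|.
  move=> k1k k2k k12 Jk1 Jk2 /leq_trans; apply.
  rewrite cardE -[matching_size k k1](size_iota 0) -[matching_size k
    k2](size_iota 0).
  rewrite -(size_map (matching_edge k k1)) -(size_map
    (matching_edge k k2)) -size_cat.
  apply: uniq_leq_size; first exact: matching_edges_uniq.
  by move=> e; rewrite mem_cat mem_enum => /orP[]; apply: side.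
have JE : [|| J c0 != J c1, J c1 != J c2 | J c0 != J c2].
  move: iZ jZ; rewrite (inZ i u ord0) (inZ j w ord0) -!/(J _).
  by case: (I3P i) => ->; case: (I3P j) => ->;
    case: (J c0); case: (J c1); case: (J c2).
have b0 := bound c0 c1 c2 isT isT isT; have b1 := bound c1 c0 c2 isT isT isT.
have b2 := bound c2 c0 c1 isT isT isT.
move: b0 b1 b2 JE; rewrite /matching_size /=.
case: (J c0); case: (J c1); case: (J c2) => //= b0 b1 b2 _;
  [apply: b2 | apply: b1 | apply: b0 | apply: b0 | apply: b1 | apply: b2] => //;
  clear; lia.
Qed.

Lemma three_cliques_connectivity : edge_connectivity G = L.
Proof.
apply/eqP; rewrite eqn_leq; apply/andP; split; last first.
  apply: leq_edge_connectivity boundary_three_cliques.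
  by rewrite card_prod !card_ord; clear; lia.
have sep0 : separates [set: G] (clique c0).
  by apply/separatesP; exists (c0, ord0), (c1, ord0); rewrite !inE.
apply: leq_trans (edge_connectivity_leq_boundary sep0) _.
have sub : boundary
  (clique c0) \subset matching_edges c0 c1 ++ matching_edges c0 c2.
  apply/subsetP=> e /boundary_clique[i [u [i0 lt_u ->]]]; rewrite mem_cat.
  case: (I3P i) i0 lt_u => -> // _ lt_u; apply/orP; [left | right];
  by apply: map_f; rewrite mem_iota.
apply: leq_trans (subset_leq_card sub) (leq_trans (card_size _) _).
by rewrite size_cat !size_map !size_iota /matching_size /=; clear; lia.
Qed.

(** One vertex of each clique, so that a tree connecting [S] must leave every clique. *)
Let S : {set G} := [set x : G | x.2 == ord0].

Lemma clique_separates j : separates S (clique j).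
Proof.
apply/separatesP; exists (j, ord0).
by case: (I3P j) => ->;
  [exists (c1, ord0) | exists (c0, ord0) | exists (c0, ord0)];
  rewrite !inE.
Qed.

Lemma three_cliques_lambda3 : lambda3 G <= (uphalf (3 * L))./2.
Proof.
have cardS : #|S| == 3.
  rewrite (_ : S = [set (i, ord0) | i : 'I_3]).
    by rewrite card_imset ?card_ord // => i j [].
  apply/setP=> -[i u]; rewrite inE /=; apply/eqP/imsetP => [->|[k _ [_ ->]]] //.
  by exists i.
apply: leq_trans (bigminn_leq _ _ cardS) _; apply/bigmax_leqP => P /andP[].
move=> /forall_inP treeP /forall_inP disjP.
pose I := [set e in edges G | [exists j, separates e (clique j)]].
have cardI : #|I| <= uphalf (3 * L).
  have sub : I \subset matching_edges c0 c1 ++ matching_edges c0 c2 ++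
    matching_edges c1 c2.
    apply/subsetP=> e; rewrite inE => /andP[eG /existsP[j ej]].
    have /boundary_clique[i [u [ij lt_u ->]]] : e \in boundary (clique j).
      by rewrite inE eG.
    rewrite !mem_cat; have sym k l : matching_edge k l u = matching_edge l k u.
      exact: setUC.
    have mem k l : u < matching_size k l ->
      matching_edge k l u \in matching_edges k l.
      by move=> lt_u'; apply: map_f; rewrite mem_iota.
    case: (I3P i) (I3P j) ij lt_u => -> [] -> // _ lt_u; rewrite 1?mem ?orbT //;
      by rewrite sym mem ?orbT.
  apply: leq_trans (subset_leq_card sub) (leq_trans (card_size _) _).
  by rewrite !size_cat !size_map !size_iota /matching_size /=; clear; lia.
have two_cross H : H \in P -> 2 <= #|H.2 :&: I|.
  move=> HP; have /and3P[/andP[sHG _] /andP[conH _] sSH] := treeP H HP.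
  have /linksP linkH := connected_graph_links conH sSH.
  have [e eH e0] := linkH _ (clique_separates c0).
  have eG := subsetP sHG e eH.
  have /boundary_clique[i [u [i0 lt_u eE]]] : e \in boundary (clique c0)
    by rewrite inE eG.
  (* [j] is the clique that [e] does not touch, so the edge leaving [j] differs from [e]. *)
  have [j ji j0] : exists2 j, j != i & j != c0.
    by case: (I3P i) i0 => -> // _; [exists c2 | exists c1].
  have [e' e'H e'j] := linkH _ (clique_separates j).
  apply/card_gt1P; exists e, e'; split.
  - by rewrite !inE eH eG; apply/existsP; exists c0.
  - by rewrite !inE e'H (subsetP sHG e' e'H); apply/existsP; exists j.
  apply: contraTneq e'j => <-; rewrite eE separates2 !inE negbK /=.
  by rewrite (eq_sym c0) (negPf j0) (eq_sym i) (negPf ji).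
(* Double counting: each tree has at least two edges of [I], and each edge is in at most one
   tree. *)
have : #|P| * 2 <= #|I|.
  have : \sum_(H in P) 2 <= \sum_(H in P) #|H.2 :&: I| by apply: leq_sum.
  rewrite sum_nat_const => /leq_trans; apply.
  have -> : \sum_(H in P) #|H.2 :&: I| = \sum_(H in P) \sum_(e
    in I) (e \in H.2).
    apply: eq_bigr => H _; rewrite -big_mkcondr -sum1_card; apply: eq_bigl => e.
    by rewrite inE andbC.
  rewrite exchange_big /= -sum1_card; apply: leq_sum => e _.
  rewrite -big_mkcondr /= sum1dep_card; apply/card_le1_eqP => H K.
  rewrite !inE => /andP[HP eH] /andP[KP eK]; apply/eqP.
  have /forall_inP/(_ K KP) := disjP H HP; apply: contraTT => HK;
    rewrite (eq_sym H) HK /=.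
  by apply/negP=> /pred0P/(_ e); rewrite /= eH eK.
move: cardI; clear; move: #|_| #|_| => p q; lia.
Qed.

End ThreeCliques.

(** * The bound in terms of [s] and [r], and the conclusion *)

Lemma packing_bound s r : r \in [:: 0; 1; 2; 3] ->
  (uphalf (3 * (4 * s + r)))./2 = 3 * s + uphalf r.
Proof. by rewrite !inE => /or4P[] /eqP->; clear; lia. Qed.

Theorem proposition4 :
  (forall G : sgraph, connected_sgraph G -> 3 <= #|G| ->
     (forall s r : nat, r \in [:: 0; 1; 2; 3] ->
        edge_connectivity G = 4 * s + r ->
        3 * s + uphalf r <= lambda3 G) /\
     ((3 * (edge_connectivity G)%:R - 2) / 4 <= (lambda3 G)%:R :> rat)%R) /\
  (forall s r : nat, r \in [:: 0; 1; 2; 3] -> 1 <= 4 * s + r ->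
     exists G : sgraph,
       [/\ connected_sgraph G, 3 <= #|G|,
           edge_connectivity G = 4 * s + r &
           lambda3 G = 3 * s + uphalf r]).
Proof.
split=> [G _ _ | s r r4 L_gt0].
  have lower := lambda3_lower_bound G; split=> [s r r4 lamE|].
    by rewrite -packing_bound // -lamE.
  rewrite ler_pdivrMr // lerBlDr -!natrM -natrD ler_nat.
  (* Halving [uphalf (3 * k)] loses at most one half, which leaves at least [(3 * k - 2) / 4]. *)
  by move: lower; move: (edge_connectivity G) (lambda3 G) => k t; lia.
have lamE := three_cliques_connectivity (4 * s + r).
have G_gt2 : 3 <= #|three_cliques (4 * s + r)|.
  by rewrite card_prod !card_ord; clear; lia.
exists (three_cliques (4 * s + r)); split=> //.
  by apply: connected_sgraph_edge_connectivity; rewrite ?lamE // ltnW.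
apply/eqP; rewrite -packing_bound // eqn_leq three_cliques_lambda3 /=.
by rewrite -[in X in X <= _]lamE lambda3_lower_bound.
Qed.
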